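(* Periodic solutions of the Kepler-Heisenberg problem exist. For any odd integer $k\ge 3$ there exists a periodic orbit of the Kepler-Heisenberg system with $k$-fold rotational symmetry about the $z$-axis; that is, there exist $T>0$ and a solution $t\mapsto (x(t),y(t),z(t),p_x(t),p_y(t),p_z(t))$, $t\in\mathbb R$, of Hamilton's equations for the Hamiltonian $H$ on $T^*(\mathbb R^3\setminus\{(0,0,0)\})$, which is $T$-periodic (in all six phase space variables) and whose configuration component $\gamma(t)=(x(t),y(t),z(t))$ satisfies $\gamma(t+T/k)=R_{2\pi/k}\,\gamma(t)$ for all $t$.
   Context: Let $\mathbb H=\mathbb R^3$ be the Heisenberg group with coordinates $(x,y,z)$, and let $(x,y,z,p_x,p_y,p_z)$ be the canonical coordinates on $T^*\mathbb H$. Put $P_X=p_x-\tfrac12 y p_z$, $P_Y=p_y+\tfrac12 x p_z$, $\mu=(x^2+y^2)^2+\tfrac1{16}z^2$, and let $\alpha>0$ be a fixed positive constant (the paper's value is $\alpha=2/\pi$, but only positivity is used). The Kepler-Heisenberg Hamiltonian is $$H=\tfrac12(P_X^2+P_Y^2)-\alpha\mu^{-1/2},$$ defined on $T^*(\mathbb H\setminus\{(0,0,0)\})$. Hamilton's equations are $\dot q_i=\partial H/\partial p_i$, $\dot p_i=-\partial H/\partial q_i$ with the canonical coordinates above. $R_{2\pi/k}$ denotes rotation of $\mathbb R^3$ about the $z$-axis by $2\pi/k$ radians counterclockwise: $R_{2\pi/k}(x,y,z)=(x\cos\tfrac{2\pi}{k}-y\sin\tfrac{2\pi}{k},\;x\sin\tfrac{2\pi}{k}+y\cos\tfrac{2\pi}{k},\;z)$.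 *)

(* Defs.v *)
From Stdlib Require Export Reals Arith.
From Coquelicot Require Export Coquelicot.

Open Scope R_scope.

(** A point of [T^*R^3] in canonical coordinates. *)
Record phase : Type := Phase {
  qx : R; qy : R; qz : R;
  px : R; py : R; pz : R
}.

Definition config (w : phase) : R * R * R := (qx w, qy w, qz w).

Definition P_X (w : phase) : R := px w - / 2 * qy w * pz w.
Definition P_Y (w : phase) : R := py w + / 2 * qx w * pz w.
Definition mu (w : phase) : R := (qx w ^ 2 + qy w ^ 2) ^ 2 + / 16 * qz w ^ 2.

(** The potential is the real function [- alpha * mu^(-1/2)] only where
    [mu w > 0], i.e. where [config w <> (0, 0, 0)]; every use of [KH] below is
    restricted to that domain. *)
Definition KH (alpha : R) (w : phase) : R :=
  / 2 * (P_X w ^ 2 + P_Y w ^ 2) - alpha * / sqrt (mu w).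

(** Partial derivatives of a function on phase space. [Derive] is total and
    returns the derivative wherever it exists; [KH alpha] is smooth at every
    [w] with [config w <> (0, 0, 0)]. *)
Definition D_qx (F : phase -> R) (w : phase) : R :=
  Derive (fun s => F (Phase s (qy w) (qz w) (px w) (py w) (pz w))) (qx w).
Definition D_qy (F : phase -> R) (w : phase) : R :=
  Derive (fun s => F (Phase (qx w) s (qz w) (px w) (py w) (pz w))) (qy w).
Definition D_qz (F : phase -> R) (w : phase) : R :=
  Derive (fun s => F (Phase (qx w) (qy w) s (px w) (py w) (pz w))) (qz w).
Definition D_px (F : phase -> R) (w : phase) : R :=
  Derive (fun s => F (Phase (qx w) (qy w) (qz w) s (py w) (pz w))) (px w).
Definition D_py (F : phase -> R) (w : phase) : R :=
  Derive (fun s => F (Phase (qx w) (qy w) (qz w) (px w) s (pz w))) (py w).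
Definition D_pz (F : phase -> R) (w : phase) : R :=
  Derive (fun s => F (Phase (qx w) (qy w) (qz w) (px w) (py w) s)) (pz w).

(** [u] is defined for all times and stays in the cotangent bundle of
    [R^3] minus the origin. *)
Definition hamilton_solution (F : phase -> R) (u : R -> phase) : Prop :=
  forall t : R,
    config (u t) <> (0, 0, 0) /\
    is_derive (fun s => qx (u s)) t (D_px F (u t)) /\
    is_derive (fun s => qy (u s)) t (D_py F (u t)) /\
    is_derive (fun s => qz (u s)) t (D_pz F (u t)) /\
    is_derive (fun s => px (u s)) t (- D_qx F (u t)) /\
    is_derive (fun s => py (u s)) t (- D_qy F (u t)) /\
    is_derive (fun s => pz (u s)) t (- D_qz F (u t)).

Definition rotz (theta : R) (q : R * R * R) : R * R * R :=
  let '(x, y, z) := q in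
  (x * cos theta - y * sin theta, x * sin theta + y * cos theta, z).

(* Main.v *)
Require Import Defs.
From Stdlib Require Import Lra Psatz Ranalysis5 IndefiniteDescription.

(** The orbits live on the zero level of two quantities: the energy [H], and
    the generator [x px + y py + 2 z pz] of the dilations
    [(x, y, z) -> (l x, l y, l^2 z)], whose derivative along the flow is [2 H],
    so that it is conserved at zero energy.  On these levels the system can be
    solved by quadratures.

    In polar coordinates put [tau = z / (4 r^2)], [a = r r'], [b = r^2 th'],
    and let [J] be the angular momentum.  Then [p_z = 2 (b - J) / r^2], and
      zero dilation generator:  [a = - 16 tau (b - J)],
      zero energy:  [a^2 + b^2 = 2 alpha / sqrt (1 + tau^2)].
    The shape [tau] of the orbit is invariant under dilations and rotations.
    Eliminating [a] gives a quadratic equation for [b] whose discriminant is a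
    positive multiple of [tau'^2] and is nonnegative exactly when
    [|shape_w tau| <= lam], where [lam = sqrt (2 alpha) / J] and [shape_w] is an
    increasing bijection of the line.  So the shape librates, and the
    substitution [shape_w tau = lam sin psi] resolves the square roots at the
    turning points: [tau], [a], [b] become smooth [2 PI]-periodic functions of
    the phase [psi], while [ln r], [th] and the time are primitives of
    explicit functions of [psi].

    The radius returns to its value after one libration, because its
    logarithmic derivative is an exact derivative plus an odd periodic function
    of [psi] ([primitive_odd_periodic]).  The reason for the oddness is that, on
    the zero level of the dilation generator, an orbit started at [z = 0] on
    the positive [x]-axis is preserved by reversing time and applying
    [(x, y, z) -> (x, - y, - z)].  Hence every such orbit is periodic up to a
    rotation about the axis.  The rotation angle of one libration is
    [W lam = RInt (fun psi => angle_density (tau psi)) 0 (2 * PI)], a continuous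
    function of [lam] which vanishes at [lam = 0] and is at least [2 PI / 3] at
    [lam = 2 shape_w 1].  The intermediate value theorem gives
    [W lam = 2 PI / k] ([winding_value]); then one libration rotates the
    orbit by [2 PI / k] and [k] librations close it. *)

(** * Calculus of inverse functions and periodic primitives *)

Lemma eq_of_derive_zero (f : R -> R) :
  (forall x, is_derive f x 0) -> forall x y, f x = f y.
Proof.
intros Hf.
assert (H : forall x y, x < y -> f x = f y).
{ intros x y Hxy. apply (eq_is_derive f x y); [|exact Hxy].
  intros t _. exact (Hf t). }
intros x y. destruct (Rtotal_order x y) as [h|[h|h]].
- now apply H.
- now rewrite h.
- symmetry; now apply H.
Qed.

Lemma derive_continuity_pt (f : R -> R) (x l : R) :
  is_derive f x l -> continuity_pt f x.
Proof.
intros H. apply derivable_continuous_pt.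
exists l. now apply is_derive_Reals.
Qed.

Lemma continuous_of_continuity_pt (f : R -> R) (x : R) :
  continuity_pt f x -> continuous f x.
Proof. intros H. now apply continuity_pt_filterlim. Qed.

Lemma derive_positive_increasing (f df : R -> R) :
  (forall x, is_derive f x (df x)) -> (forall x, 0 < df x) ->
  forall x y, x < y -> f x < f y.
Proof.
intros Hf Hpos x y Hxy.
destruct (MVT_gen f x y df) as [c [_ Hc]].
- intros z _. apply Hf.
- intros z _. exact (derive_continuity_pt _ _ _ (Hf z)).
- specialize (Hpos c). nra.
Qed.

(** Used twice: to recover the shape from [lam sin psi], and to recover the
    phase from the time. *)
Lemma smooth_inverse (f df : R -> R) :
  (forall x, is_derive f x (df x)) -> (forall x, 0 < df x) ->
  (forall y, exists x, f x <= y) -> (forall y, exists x, y <= f x) ->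
  exists g : R -> R,
    (forall y, f (g y) = y) /\ (forall x, g (f x) = x) /\
    (forall y, is_derive g y (/ df (g y))).
Proof.
intros Hf Hpos Hlo Hhi.
assert (Hinc := derive_positive_increasing f df Hf Hpos).
assert (Hcont : continuity f).
{ intros x. exact (derive_continuity_pt _ _ _ (Hf x)). }
assert (Hsurj : forall y, exists x, f x = y).
{ intros y. destruct (Hlo y) as [a Ha]. destruct (Hhi y) as [b Hb].
  destruct (IVT_gen f a b y Hcont) as [x [_ Hx]].
  - unfold Rmin, Rmax. repeat destruct Rle_dec; lra.
  - now exists x. }
pose (g := fun y => proj1_sig (constructive_indefinite_description _ (Hsurj y))).
assert (Hfg : forall y, f (g y) = y).
{ intros y. unfold g. now destruct constructive_indefinite_description. }
assert (Hgf : forall x, g (f x) = x).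
{ intros x. destruct (Rtotal_order (g (f x)) x) as [h|[h|h]]; [|exact h|];
  apply Hinc in h; rewrite Hfg in h; lra. }
exists g. split; [exact Hfg|split; [exact Hgf|]].
assert (Hgc : forall y, continuity_pt g y).
{ intros y.
  apply (continuity_pt_recip_prelim f g (g y - 1) (g y + 1)).
  - lra.
  - intros u v _ huv _. now apply Hinc.
  - intros u _. unfold comp, id. apply Hgf.
  - intros u _. apply Hcont.
  - rewrite <- (Hfg y) at 2 3. split; apply Hinc; lra. }
intros y.
assert (Hmon : forall u v, u < v -> g u < g v).
{ intros u v huv. destruct (Rlt_or_le (g u) (g v)) as [h|[h|h]]; [exact h| |].
  - apply Hinc in h. rewrite !Hfg in h. lra.
  - apply (f_equal f) in h. rewrite !Hfg in h. lra. }
assert (Prf : forall a, g (y - 1) <= a <= g (y + 1) -> derivable_pt f a).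
{ intros a _. exists (df a). now apply is_derive_Reals. }
assert (Hin : g (y - 1) <= g y <= g (y + 1)).
{ split; left; apply Hmon; lra. }
assert (Hd : derive_pt f (g y) (Prf (g y) Hin) = df (g y)).
{ apply derive_pt_eq_0. now apply is_derive_Reals. }
apply is_derive_Reals.
replace (/ df (g y)) with (1 / derive_pt f (g y) (Prf (g y) Hin))
  by (rewrite Hd; unfold Rdiv; ring).
apply derivable_pt_lim_recip_interv; try lra.
- apply Hgc.
- intros x _. apply Hfg.
- rewrite Hd. specialize (Hpos (g y)). lra.
Qed.

Lemma primitive_derive (f : R -> R) :
  (forall x, continuous f x) -> forall x, is_derive (fun y => RInt f 0 y) x (f x).
Proof.
intros Hf x. apply (is_derive_RInt f (fun y => RInt f 0 y) 0 x).
- apply filter_forall. intros y. apply (RInt_correct f).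
  apply (ex_RInt_continuous f). intros z _. apply Hf.
- apply Hf.
Qed.

Lemma primitive_shift (f : R -> R) (p : R) :
  (forall x, continuous f x) -> (forall x, f (x + p) = f x) ->
  forall x, RInt f 0 (x + p) = RInt f 0 x + RInt f 0 p.
Proof.
intros Hf Hp x.
pose (G := fun x => RInt f 0 (x + p) - RInt f 0 x).
assert (HG : G x = G 0).
{ apply eq_of_derive_zero. intros z.
  assert (E : 1 * f (z + p) - f z = 0) by (rewrite Hp; ring).
  refine (eq_ind _ (is_derive G z) _ _ E). unfold G.
  apply (is_derive_minus (fun x => RInt f 0 (x + p))).
  - apply (is_derive_comp (fun y => RInt f 0 y) (fun x => x + p)).
    + now apply primitive_derive.
    + auto_derive; [easy|ring].
  - now apply primitive_derive. }
unfold G in HG. rewrite Rplus_0_l in HG.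
assert (H0 : RInt f 0 0 = 0) by apply (RInt_point 0 f).
lra.
Qed.

(** The primitive of an odd function is even, so it agrees at [- p / 2] and
    [p / 2], and the increment over a period vanishes. *)
Lemma primitive_odd_periodic (f : R -> R) (p : R) :
  (forall x, continuous f x) -> (forall x, f (x + p) = f x) ->
  (forall x, f (- x) = - f x) ->
  forall x, RInt f 0 (x + p) = RInt f 0 x.
Proof.
intros Hf Hp Hodd.
assert (Heven : forall x, RInt f 0 (- x) = RInt f 0 x).
{ intros x.
  pose (G := fun x => RInt f 0 (- x) - RInt f 0 x).
  assert (HG : G x = G 0).
  { apply eq_of_derive_zero. intros z.
    assert (E : - (1) * f (- z) - f z = 0) by (rewrite Hodd; ring).
    refine (eq_ind _ (is_derive G z) _ _ E). unfold G.
    apply (is_derive_minus (fun x => RInt f 0 (- x))).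
    - apply (is_derive_comp (fun y => RInt f 0 y) (fun x => - x)).
      + now apply primitive_derive.
      + auto_derive; [easy|ring].
    - now apply primitive_derive. }
  unfold G in HG. rewrite Ropp_0 in HG. lra. }
assert (Hz : RInt f 0 p = 0).
{ pose proof (primitive_shift f p Hf Hp (- (p / 2))) as H.
  rewrite Heven in H. replace (- (p / 2) + p) with (p / 2) in H by field. lra. }
intros x. rewrite primitive_shift by assumption. rewrite Hz. apply Rplus_0_r.
Qed.

Lemma shift_iterate (F : R -> R) (p c : R) :
  (forall x, F (x + p) = F x + c) ->
  forall n x, F (x + INR n * p) = F x + INR n * c.
Proof.
intros H n x. induction n as [|n IH].
- simpl. rewrite !Rmult_0_l, !Rplus_0_r. reflexivity.
- rewrite S_INR.
  assert (E : x + (INR n + 1) * p = x + INR n * p + p) by ring.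
  rewrite E, H, IH. ring.
Qed.

Lemma archimedean_multiple (c y : R) : 0 < c -> exists n, y <= INR n * c.
Proof.
intros Hc. destruct (INR_unbounded (y / c)) as [n Hn]. exists n.
apply Rmult_gt_compat_r with (r := c) in Hn; [|exact Hc].
replace (y / c * c) with y in Hn by (field; lra). lra.
Qed.

(** Change of time: [f] is the rate of time with respect to a phase [s], and
    the phase is obtained by inverting the primitive of [f].  This primitive
    is onto since it grows by the same positive amount over each period. *)
Lemma periodic_clock (f : R -> R) (p : R) :
  0 < p -> (forall x, continuous f x) -> (forall x, f (x + p) = f x) ->
  (forall x, 0 < f x) ->
  exists (T : R) (s : R -> R), 0 < T /\
    (forall t, is_derive s t (/ f (s t))) /\ (forall t, s (t + T) = s t + p).
Proof.
intros Hp0 Hf Hp Hpos.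
pose (F := fun y => RInt f 0 y).
assert (HF : forall x, is_derive F x (f x)) by now apply primitive_derive.
assert (HT : 0 < F p).
{ apply RInt_gt_0; [exact Hp0| |]; intros; [apply Hpos|apply Hf]. }
assert (HFp : forall x, F (x + p) = F x + F p) by now apply primitive_shift.
assert (HF0 : F 0 = 0) by apply (RInt_point 0 f).
destruct (smooth_inverse F f HF Hpos) as (s & HFs & HsF & Hs).
- intros y. destruct (archimedean_multiple (F p) (- y) HT) as [n Hn].
  exists (- (INR n * p)).
  pose proof (shift_iterate F p (F p) HFp n (- (INR n * p))) as H.
  rewrite Rplus_opp_l in H. lra.
- intros y. destruct (archimedean_multiple (F p) y HT) as [n Hn].
  exists (0 + INR n * p). rewrite (shift_iterate F p (F p) HFp). lra.
- exists (F p), s. split; [exact HT|split; [exact Hs|]].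
  intros t. rewrite <- (HsF (s t + p)), HFp, HFs. reflexivity.
Qed.

(** The arguments [l * sin x] stay in a compact interval when [l] does, where
    [f] is uniformly continuous. *)
Lemma continuity_RInt_scaled_sin (f : R -> R) (b : R) :
  0 < b -> continuity f ->
  continuity (fun l => RInt (fun x => f (l * sin x)) 0 b).
Proof.
intros Hb Hf l.
assert (Hex : forall l, ex_RInt (fun x => f (l * sin x)) 0 b).
{ intros l'. apply (ex_RInt_continuous (fun x => f (l' * sin x))). intros z _.
  apply continuous_of_continuity_pt.
  apply (continuity_pt_comp (fun x => l' * sin x) f); [|apply Hf].
  apply (derive_continuity_pt _ _ (l' * cos z)). auto_derive; [easy|ring]. }
apply continuity_pt_filterlim. apply filterlim_locally. intros eps.
set (M := Rabs l + 1).
assert (He : 0 < eps / (2 * b)).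
{ apply Rdiv_lt_0_compat; [apply cond_pos|lra]. }
destruct (@Heine_cor2 f (- M) M (fun x _ => Hf x) (mkposreal _ He)) as [d Hd].
assert (Hd1 : 0 < Rmin d 1) by (apply Rmin_pos; [apply cond_pos|lra]).
exists (mkposreal _ Hd1). intros y Hy.
change (Rabs (y - l) < Rmin d 1) in Hy.
change (Rabs (RInt (fun x => f (y * sin x)) 0 b
              - RInt (fun x => f (l * sin x)) 0 b) < eps).
replace (RInt (fun x => f (y * sin x)) 0 b - RInt (fun x => f (l * sin x)) 0 b)
  with (RInt (fun x => f (y * sin x) - f (l * sin x)) 0 b).
2:{ apply (RInt_minus (fun x => f (y * sin x)) (fun x => f (l * sin x))); apply Hex. }
apply Rle_lt_trans with ((b - 0) * (eps / (2 * b))).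
- apply abs_RInt_le_const; [lra| |].
  + apply (ex_RInt_minus (fun x => f (y * sin x)) (fun x => f (l * sin x))); apply Hex.
  + intros t _. left.
    pose proof (Rmin_l d 1). pose proof (Rmin_r d 1).
    assert (Hs : Rabs (sin t) <= 1) by (apply Rabs_le; apply SIN_bound).
    assert (Hbd : forall u, Rabs u <= M -> - M <= u * sin t <= M).
    { intros u Hu. apply Rabs_le_between. rewrite Rabs_mult.
      pose proof (Rabs_pos u). pose proof (Rabs_pos (sin t)). nra. }
    apply Hd.
    * apply Hbd. unfold M.
      replace y with (l + (y - l)) by ring.
      pose proof (Rabs_triang l (y - l)). lra.
    * apply Hbd. unfold M. lra.
    * replace (y * sin t - l * sin t) with ((y - l) * sin t) by ring.
      rewrite Rabs_mult.
      pose proof (Rabs_pos (y - l)). pose proof (Rabs_pos (sin t)). nra.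
- pose proof (cond_pos eps).
  replace ((b - 0) * (eps / (2 * b))) with (eps / 2) by (field; lra). lra.
Qed.

(** * The Hamiltonian flow in polar coordinates *)

Lemma KH_gradient (alpha : R) (w : phase) :
  0 < mu w ->
  D_px (KH alpha) w = P_X w /\
  D_py (KH alpha) w = P_Y w /\
  D_pz (KH alpha) w = / 2 * (qx w * P_Y w - qy w * P_X w) /\
  D_qx (KH alpha) w = / 2 * pz w * P_Y w
    + 2 * alpha * qx w * (qx w ^ 2 + qy w ^ 2) / (mu w * sqrt (mu w)) /\
  D_qy (KH alpha) w = - (/ 2 * pz w * P_X w)
    + 2 * alpha * qy w * (qx w ^ 2 + qy w ^ 2) / (mu w * sqrt (mu w)) /\
  D_qz (KH alpha) w = alpha * qz w / (16 * (mu w * sqrt (mu w))).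
Proof.
intros Hmu.
assert (Hs : 0 < sqrt (mu w)) by now apply sqrt_lt_R0.
assert (Hmu2 : mu w = sqrt (mu w) * sqrt (mu w)) by (symmetry; apply sqrt_sqrt; lra).
destruct w as [x y z u v p].
unfold D_px, D_py, D_pz, D_qx, D_qy, D_qz, KH, P_X, P_Y; simpl.
repeat split; apply is_derive_unique; unfold mu in *; simpl in *.
1-3: auto_derive; [easy|field].
all: match type of Hmu2 with ?m = _ => set (M := m) in * end.
all: auto_derive;
  [ change (0 < M /\ sqrt M <> 0 /\ True); repeat split; lra
  | match goal with |- context [sqrt ?m] => change m with M end;
    set (S := sqrt M) in *; clearbody S; clearbody M; subst M; field; lra ].
Qed.

(** Here [J] is the angular momentum [x py - y px], [a = r r'] and
    [b = r^2 th']; the momenta are the ones for which [P_X + i P_Y] is the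
    velocity [(a + i b) e^(i th) / r] and [th' = J / r^2 + pz / 2]. *)
Definition polar_phase (J r th tau a b : R) : phase :=
  Phase (r * cos th) (r * sin th) (4 * r ^ 2 * tau)
    ((a * cos th - J * sin th) / r) ((a * sin th + J * cos th) / r)
    (2 * (b - J) / r ^ 2).

Lemma sqrt_mu_polar (J r th tau a b : R) :
  0 < r ->
  let w := polar_phase J r th tau a b in
  mu w = (r ^ 2 * sqrt (1 + tau ^ 2)) ^ 2 /\ sqrt (mu w) = r ^ 2 * sqrt (1 + tau ^ 2).
Proof.
intros Hr w.
assert (H : mu w = (r ^ 2 * sqrt (1 + tau ^ 2)) ^ 2).
{ rewrite Rpow_mult_distr, pow2_sqrt by nra.
  unfold mu, w, polar_phase; simpl qx; simpl qy; simpl qz.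
  replace ((r * cos th) ^ 2 + (r * sin th) ^ 2) with (r ^ 2 * (Rsqr (sin th) + Rsqr (cos th)))
    by (unfold Rsqr; ring).
  rewrite sin2_cos2. field. }
split; [exact H|]. rewrite H. apply sqrt_pow2.
apply Rmult_le_pos; [nra|apply sqrt_pos].
Qed.

(** Hamilton's equations in these coordinates.  Up to the factor [1 / r^2],
    which only changes the time, the equations for [tau], [a] and [b] do not
    involve [r] and [th]: this reflects the invariance under dilations and
    rotations. *)
Lemma hamilton_solution_polar (alpha J : R) (r th tau a b : R -> R) :
  (forall t, 0 < r t) ->
  (forall t, is_derive r t (a t / r t)) ->
  (forall t, is_derive th t (b t / r t ^ 2)) ->
  (forall t, is_derive tau t ((b t / 8 - 2 * tau t * a t) / r t ^ 2)) ->
  (forall t, is_derive a t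
     ((a t ^ 2 - b t ^ 2 + 2 * J * b t - 2 * alpha / sqrt (1 + tau t ^ 2) ^ 3)
      / r t ^ 2)) ->
  (forall t, is_derive b t
     ((2 * a t * (b t - J) - alpha * tau t / (8 * sqrt (1 + tau t ^ 2) ^ 3))
      / r t ^ 2)) ->
  hamilton_solution (KH alpha)
    (fun t => polar_phase J (r t) (th t) (tau t) (a t) (b t)).
Proof.
intros Hr Dr Dth Dtau Da Db t.
assert (Hrt := Hr t).
destruct (sqrt_mu_polar J (r t) (th t) (tau t) (a t) (b t) Hrt) as [Hmu Hsq].
assert (Hs : 0 < sqrt (1 + tau t ^ 2)) by (apply sqrt_lt_R0; nra).
assert (Hs2 : sqrt (1 + tau t ^ 2) ^ 2 = 1 + tau t ^ 2) by (apply pow2_sqrt; nra).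
assert (Hr2 : 0 < r t ^ 2) by nra.
assert (Htr : sin (th t) ^ 2 = 1 - cos (th t) ^ 2).
{ pose proof (sin2_cos2 (th t)) as H. unfold Rsqr in H. lra. }
assert (Hpos : 0 < mu (polar_phase J (r t) (th t) (tau t) (a t) (b t))).
{ rewrite Hmu. apply pow_lt. nra. }
destruct (KH_gradient alpha _ Hpos) as (Gpx & Gpy & Gpz & Gqx & Gqy & Gqz).
rewrite Gpx, Gpy, Gpz, Gqx, Gqy, Gqz, Hsq, Hmu.
set (s := sqrt (1 + tau t ^ 2)) in *.
assert (Ex : ex_derive r t /\ ex_derive th t /\ ex_derive tau t /\
             ex_derive a t /\ ex_derive b t)
  by (repeat split; eexists; eauto).
destruct Ex as (Er & Eth & Etau & Ea & Eb).
assert (Fr : Derive (fun x => r x) t = _) by apply (is_derive_unique _ _ _ (Dr t)).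
assert (Fth : Derive (fun x => th x) t = _) by apply (is_derive_unique _ _ _ (Dth t)).
assert (Ftau : Derive (fun x => tau x) t = _) by apply (is_derive_unique _ _ _ (Dtau t)).
assert (Fa : Derive (fun x => a x) t = _) by apply (is_derive_unique _ _ _ (Da t)).
assert (Fb : Derive (fun x => b x) t = _) by apply (is_derive_unique _ _ _ (Db t)).
split.
{ intros H. unfold config, polar_phase in H; simpl in H. injection H as Hx Hy Hz.
  assert (r t ^ 2 = 0); [|lra].
  replace (r t ^ 2) with (r t ^ 2 * (sin (th t) ^ 2 + cos (th t) ^ 2)) by (rewrite Htr; ring).
  replace (r t ^ 2 * (sin (th t) ^ 2 + cos (th t) ^ 2))
    with ((r t * cos (th t)) ^ 2 + (r t * sin (th t)) ^ 2) by ring.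
  rewrite Hx, Hy. ring. }
unfold polar_phase, P_X, P_Y. cbn [qx qy qz px py pz].
refine (conj _ (conj _ (conj _ (conj _ (conj _ _)))));
  auto_derive;
  try (repeat split; auto; lra);
  rewrite ?Fr, ?Fth, ?Ftau, ?Fa, ?Fb; fold s;
clear - Hrt Hs Htr;
generalize dependent (cos (th t)); generalize dependent (sin (th t));
intros S C HS; field [HS]; lra.
Qed.

(** * The turning function of the shape *)

(** The argument [y] stands for [tau = z / (4 r^2)].  Dividing [a] and [b] by
    [J], the relation [a = - 16 tau (b - J)] and zero energy give for
    [beta = b / J] the equation
    [shape_E y * beta^2 - 512 y^2 beta + 256 y^2 = lam^2 / sqrt (1 + y^2)],
    that is, [(shape_E y * beta - 256 y^2)^2 = (lam * shape_m y)^2 - (16 y)^2]. *)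
Definition shape_E (y : R) : R := 1 + 256 * y ^ 2.
(** This factor measures the derivative of [shape_w], see [is_derive_shape_w];
    along an orbit [2 J shape_q / r^2] is the speed of the phase [psi]. *)
Definition shape_q (y : R) : R := / shape_E y + y ^ 2 / (2 * (1 + y ^ 2)).
Definition shape_m (y : R) : R := sqrt (shape_E y / sqrt (1 + y ^ 2)).
(** The equation for [beta] has real solutions when [|shape_w y| <= lam], so
    the solutions of [shape_w y = lam] and [shape_w y = - lam] are the turning
    points of the shape. *)
Definition shape_w (y : R) : R := 16 * y / shape_m y.

Lemma shape_E_pos y : 0 < shape_E y.
Proof. unfold shape_E. nra. Qed.

Lemma shape_q_pos y : 0 < shape_q y.
Proof.
unfold shape_q. apply Rplus_lt_le_0_compat.
- apply Rinv_0_lt_compat, shape_E_pos.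
- apply Rdiv_le_0_compat; nra.
Qed.

Lemma shape_m_sqr y : shape_m y ^ 2 = shape_E y / sqrt (1 + y ^ 2).
Proof.
apply pow2_sqrt. apply Rdiv_le_0_compat; [left; apply shape_E_pos|].
apply sqrt_lt_R0. nra.
Qed.

Lemma shape_m_pos y : 0 < shape_m y.
Proof.
apply sqrt_lt_R0, Rdiv_lt_0_compat; [apply shape_E_pos|].
apply sqrt_lt_R0. nra.
Qed.

Lemma is_derive_shape_m y :
  is_derive shape_m y
    (shape_m y / 2 * (512 * y / shape_E y - y / (1 + y ^ 2))).
Proof.
assert (HE := shape_E_pos y). assert (Hm := shape_m_pos y).
assert (Hm2 := shape_m_sqr y).
assert (Hs : 0 < sqrt (1 + y ^ 2)) by (apply sqrt_lt_R0; nra).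
assert (Hs2 : sqrt (1 + y ^ 2) ^ 2 = 1 + y ^ 2) by (apply pow2_sqrt; nra).
unfold shape_m, shape_E in *.
auto_derive; replace (y * (y * 1)) with (y ^ 2) by ring.
- repeat split; try lra.
  apply Rmult_lt_0_compat; [lra|now apply Rinv_0_lt_compat].
- unfold Rdiv in *.
  set (s := sqrt (1 + y ^ 2)) in *.
  set (m := sqrt ((1 + 256 * y ^ 2) * / s)) in *.
  clearbody m. clearbody s.
  rewrite <- Hs2.
  assert (Hm3 : 1 + 256 * y ^ 2 = m ^ 2 * s) by (rewrite Hm2; field; lra).
  rewrite Hm3. field. lra.
Qed.

Lemma is_derive_shape_w y :
  is_derive shape_w y (16 * shape_q y / shape_m y).
Proof.
assert (HE := shape_E_pos y). assert (Hm := shape_m_pos y).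
assert (Dm : Derive (fun x => shape_m x) y = _)
  by apply (is_derive_unique _ _ _ (is_derive_shape_m y)).
unfold shape_w. auto_derive.
- repeat split; [eexists; apply is_derive_shape_m|lra].
- rewrite Dm. unfold shape_q, shape_E in *. field. repeat split; nra.
Qed.

Lemma shape_w_opp y : shape_w (- y) = - shape_w y.
Proof.
unfold shape_w. replace (shape_m (- y)) with (shape_m y).
- field. apply Rgt_not_eq, shape_m_pos.
- unfold shape_m, shape_E. now replace ((- y) ^ 2) with (y ^ 2) by ring.
Qed.

(** [shape_w y] grows like the square root of [y]. *)
Lemma shape_w_large v : exists y, v <= shape_w y.
Proof.
exists (1 + v ^ 2).
set (y := 1 + v ^ 2). assert (Hy : 1 <= y) by (unfold y; nra).
assert (Hm := shape_m_pos y). assert (Hm2 := shape_m_sqr y).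
assert (Hs : y <= sqrt (1 + y ^ 2)).
{ rewrite <- (sqrt_pow2 y) at 1 by lra. apply sqrt_le_1_alt. lra. }
unfold shape_w. apply Rmult_le_reg_r with (shape_m y); [exact Hm|].
replace (16 * y / shape_m y * shape_m y) with (16 * y) by (field; lra).
assert (Hb : shape_m y ^ 2 * y <= shape_E y).
{ rewrite Hm2. apply Rmult_le_reg_r with (sqrt (1 + y ^ 2)); [lra|].
  replace (shape_E y / sqrt (1 + y ^ 2) * y * sqrt (1 + y ^ 2))
    with (shape_E y * y) by (field; lra).
  pose proof (shape_E_pos y). nra. }
unfold shape_E in Hb.
assert (Hv : v ^ 2 <= y) by (unfold y; lra).
destruct (Rle_or_lt v 0) as [h|h]; [nra|].
apply Rsqr_incr_0_var; [|lra]. unfold Rsqr.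
assert (Hm3 : shape_m y ^ 2 <= 256 * y + / y).
{ apply Rmult_le_reg_r with y; [lra|].
  replace ((256 * y + / y) * y) with (1 + 256 * y ^ 2) by (field; lra). exact Hb. }
assert (/ y <= 1) by (rewrite <- Rinv_1; apply Rinv_le_contravar; lra).
assert (v ^ 2 * shape_m y ^ 2 <= (y - 1) * (256 * y + 1)).
{ apply Rmult_le_compat; [nra|nra|unfold y; lra|lra]. }
nra.
Qed.

Lemma shape_w_inverse : exists V : R -> R,
  (forall v, shape_w (V v) = v) /\ (forall y, V (shape_w y) = y) /\
  (forall v, is_derive V v (shape_m (V v) / (16 * shape_q (V v)))).
Proof.
destruct (smooth_inverse shape_w (fun y => 16 * shape_q y / shape_m y))
  as (V & H1 & H2 & H3).
- apply is_derive_shape_w.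
- intros y. apply Rdiv_lt_0_compat; [|apply shape_m_pos].
  pose proof (shape_q_pos y). lra.
- intros v. destruct (shape_w_large (- v)) as [y Hy]. exists (- y).
  rewrite shape_w_opp. lra.
- apply shape_w_large.
- exists V. split; [exact H1|split; [exact H2|]]. intros v.
  replace (shape_m (V v) / (16 * shape_q (V v)))
    with (/ (16 * shape_q (V v) / shape_m (V v))); [apply H3|].
  pose proof (shape_q_pos (V v)). pose proof (shape_m_pos (V v)).
  field. lra.
Qed.

(** * The librating orbits as functions of the phase *)

(** The normalized quantities [b / J] and [a / J] on the orbit of shape
    parameter [lam], where [c] is the cosine of the phase: the square root of
    the discriminant [(lam * shape_m y)^2 - (16 y)^2] is
    [lam * shape_m y * c], with the sign that makes it smooth. *)
Definition orbit_beta (lam y c : R) : R :=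
  (256 * y ^ 2 + lam * shape_m y * c) / shape_E y.
Definition orbit_kappa (lam y c : R) : R := 16 * y * (1 - orbit_beta lam y c).

Section ReducedOrbit.

Variables (lam : R) (tau : R -> R).
Hypothesis lam_pos : 0 < lam.
Hypothesis tau_derive : forall psi,
  is_derive tau psi (lam * shape_m (tau psi) * cos psi / (16 * shape_q (tau psi))).
Hypothesis tau_phase : forall psi, shape_w (tau psi) = lam * sin psi.

Let beta psi := orbit_beta lam (tau psi) (cos psi).
Let kappa psi := orbit_kappa lam (tau psi) (cos psi).

Lemma tau_equation psi :
  is_derive tau psi
    ((beta psi / 8 - 2 * tau psi * kappa psi) / (2 * shape_q (tau psi))).
Proof.
replace (_ / _) with (lam * shape_m (tau psi) * cos psi / (16 * shape_q (tau psi)));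
  [apply tau_derive|].
pose proof (shape_q_pos (tau psi)). pose proof (shape_E_pos (tau psi)).
unfold beta, kappa, orbit_kappa, orbit_beta.
generalize dependent (shape_q (tau psi)). intros q Hq.
unfold shape_E in *. field. lra.
Qed.

(** Since [16 tau = lam * shape_m tau * sin psi]. *)
Lemma phase_pythagoras psi :
  (lam * shape_m (tau psi) * cos psi) ^ 2
  = lam ^ 2 * shape_m (tau psi) ^ 2 - 256 * tau psi ^ 2.
Proof.
assert (H : 16 * tau psi = lam * sin psi * shape_m (tau psi)).
{ rewrite <- tau_phase. unfold shape_w. field.
  apply Rgt_not_eq, shape_m_pos. }
replace (256 * tau psi ^ 2) with ((16 * tau psi) ^ 2) by ring.
rewrite H. pose proof (sin2_cos2 psi) as H2. unfold Rsqr in H2.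
replace (lam ^ 2 * shape_m (tau psi) ^ 2) with
  (lam ^ 2 * shape_m (tau psi) ^ 2 * (sin psi * sin psi + cos psi * cos psi))
  by (rewrite H2; ring).
ring.
Qed.

(** The equations for [a] and [b] contain the cube of [1 / sqrt (1 + y^2)];
    this turns it into a rational expression, so that the equations of motion become
    identities between rational functions of [tau] and
    [lam * shape_m tau * cos psi]. *)
Lemma cube_identity y :
  lam ^ 2 / sqrt (1 + y ^ 2) ^ 3
  = lam ^ 2 * shape_m y ^ 2 / (shape_E y * (1 + y ^ 2)).
Proof.
rewrite shape_m_sqr.
assert (Hs : 0 < sqrt (1 + y ^ 2)) by (apply sqrt_lt_R0; nra).
assert (Hs2 : sqrt (1 + y ^ 2) ^ 2 = 1 + y ^ 2) by (apply pow2_sqrt; nra).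
pose proof (shape_E_pos y).
set (s := sqrt (1 + y ^ 2)) in *. rewrite <- Hs2. field. lra.
Qed.

(** Differentiating the two conservation laws would give [b'] only away from
    the turning points, where they are not transverse; the explicit formula
    for [beta] gives it everywhere. *)
Lemma beta_equation psi :
  is_derive beta psi
    ((2 * kappa psi * (beta psi - 1)
      - lam ^ 2 / sqrt (1 + tau psi ^ 2) ^ 3 * tau psi / 16)
     / (2 * shape_q (tau psi))).
Proof.
assert (HE := shape_E_pos (tau psi)).
assert (Hm := shape_m_pos (tau psi)).
assert (Hsin : sin psi = 16 * tau psi / (lam * shape_m (tau psi))).
{ apply Rmult_eq_reg_l with lam; [|lra].
  rewrite <- tau_phase. unfold shape_w. field. lra. }
assert (Hpy := phase_pythagoras psi).
rewrite cube_identity.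
assert (Et : Derive (fun s => tau s) psi = _)
  by apply (is_derive_unique _ _ _ (tau_derive psi)).
assert (Em : Derive (fun y => shape_m y) (tau psi) = _)
  by apply (is_derive_unique _ _ _ (is_derive_shape_m (tau psi))).
unfold beta at 1, orbit_beta, shape_E.
auto_derive.
- unfold shape_E in HE; simpl in HE.
  repeat split; try (eexists; apply tau_derive);
    [eexists; apply is_derive_shape_m|lra].
- rewrite Em, Et. unfold kappa, beta, orbit_kappa, orbit_beta.
  set (X := lam * shape_m (tau psi) * cos psi) in *.
  assert (Hcos : cos psi = X / (lam * shape_m (tau psi)))
    by (unfold X; field; lra).
  replace (lam ^ 2 * shape_m (tau psi) ^ 2)
    with (X ^ 2 + 256 * tau psi ^ 2) by lra.
  rewrite Hsin, Hcos. clearbody X. clear - HE Hm lam_pos.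
  generalize dependent (shape_m (tau psi)). generalize dependent (tau psi).
  intros y HE m Hm. unfold shape_q, shape_E in *.
  field. repeat split; nra.
Qed.

Lemma kappa_equation psi :
  is_derive kappa psi
    ((kappa psi ^ 2 - beta psi ^ 2 + 2 * beta psi
      - lam ^ 2 / sqrt (1 + tau psi ^ 2) ^ 3)
     / (2 * shape_q (tau psi))).
Proof.
assert (Et : Derive (fun s => tau s) psi = _)
  by apply (is_derive_unique _ _ _ (tau_equation psi)).
assert (Eb : Derive (fun s => beta s) psi = _)
  by apply (is_derive_unique _ _ _ (beta_equation psi)).
assert (Hpy := phase_pythagoras psi).
assert (HE := shape_E_pos (tau psi)).
change kappa with (fun psi => 16 * tau psi * (1 - beta psi)) at 1.
auto_derive.
- repeat split; eexists; [apply tau_equation|apply beta_equation].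
- rewrite Et, Eb, cube_identity.
  unfold kappa, beta, orbit_kappa, orbit_beta.
  set (X := lam * shape_m (tau psi) * cos psi) in *.
  replace (lam ^ 2 * shape_m (tau psi) ^ 2)
    with (X ^ 2 + 256 * tau psi ^ 2) by lra.
  clearbody X. clear - HE. generalize dependent (tau psi).
  intros y HE. unfold shape_q, shape_E in *.
  field. repeat split; nra.
Qed.

End ReducedOrbit.

(** * The rotation angle of a libration *)

(** The derivatives of [th] and [ln r] with respect to the phase, each up to
    the derivative of a function of the shape, namely [atan (16 tau) / 2] and
    [- ln (shape_E tau) / 4].  Removing these exact terms removes [cos psi]. *)
Definition angle_density (y : R) : R := 128 * y ^ 2 / (shape_E y * shape_q y).
Definition scale_density (y : R) : R := 8 * y / (shape_E y * shape_q y).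

Lemma ex_derive_densities y :
  ex_derive angle_density y /\ ex_derive scale_density y /\ ex_derive shape_q y.
Proof.
assert (HE := shape_E_pos y). assert (Hq := shape_q_pos y).
assert (HEq := Rmult_lt_0_compat _ _ HE Hq).
assert (Dq : ex_derive shape_q y).
{ unfold shape_q, shape_E in *. auto_derive. simpl in *. repeat split; nra. }
assert (DE : ex_derive shape_E y) by (unfold shape_E; auto_derive; easy).
unfold angle_density, scale_density.
split; [|split; [|exact Dq]]; auto_derive; repeat split; trivial; lra.
Qed.

Lemma continuity_of_ex_derive (f : R -> R) (x : R) :
  ex_derive f x -> continuity_pt f x.
Proof. intros [l Hl]. exact (derive_continuity_pt _ _ _ Hl). Qed.

Lemma angle_density_nonneg y : 0 <= angle_density y.
Proof.
apply Rdiv_le_0_compat; [nra|].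
apply Rmult_lt_0_compat; [apply shape_E_pos|apply shape_q_pos].
Qed.

Lemma angle_density_ge_1 y : 1 <= y -> 1 <= angle_density y.
Proof.
intros Hy.
assert (HEq := Rmult_lt_0_compat _ _ (shape_E_pos y) (shape_q_pos y)).
apply Rmult_le_reg_r with (shape_E y * shape_q y); [exact HEq|].
unfold angle_density.
replace (128 * y ^ 2 / (shape_E y * shape_q y) * (shape_E y * shape_q y))
  with (128 * y ^ 2)
  by (field; split; [apply Rgt_not_eq, shape_q_pos|apply Rgt_not_eq, shape_E_pos]).
replace (shape_E y * shape_q y) with (1 + y ^ 2 * shape_E y / (2 * (1 + y ^ 2)))
  by (unfold shape_q; field; split; [nra|apply Rgt_not_eq, shape_E_pos]).
unfold shape_E.
apply Rmult_le_reg_r with (2 * (1 + y ^ 2)); [nra|].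
replace (1 * (1 + y ^ 2 * (1 + 256 * y ^ 2) / (2 * (1 + y ^ 2))) * (2 * (1 + y ^ 2)))
  with (2 * (1 + y ^ 2) + y ^ 2 * (1 + 256 * y ^ 2)) by (field; nra).
nra.
Qed.

(** At [lam = 0] the shape is constantly [0], where the density vanishes.
    For [lam = 2 shape_w 1] the shape exceeds [1] while [sin psi >= 1 / 2], that
    is, on a phase interval of length [2 PI / 3], and the density is at least
    [1] there. *)
Lemma winding_value (V : R -> R) (delta : R) :
  (forall v, shape_w (V v) = v) -> (forall y, V (shape_w y) = y) ->
  (forall v, is_derive V v (shape_m (V v) / (16 * shape_q (V v)))) ->
  0 < delta <= 2 * PI / 3 ->
  exists lam, 0 < lam /\
    RInt (fun psi => angle_density (V (lam * sin psi))) 0 (2 * PI) = delta.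
Proof.
intros HwV HVw DV Hdelta.
assert (Hpi := PI_RGT_0).
assert (Vinc := derive_positive_increasing V _ DV).
assert (Hpos : forall v, 0 < shape_m (V v) / (16 * shape_q (V v))).
{ intros v. pose proof (shape_q_pos (V v)).
  apply Rdiv_lt_0_compat; [apply shape_m_pos|lra]. }
specialize (Vinc Hpos).
pose (f := fun v => angle_density (V v)).
assert (Hf : continuity f).
{ intros v. apply (continuity_pt_comp V angle_density).
  - exact (derive_continuity_pt _ _ _ (DV v)).
  - apply continuity_of_ex_derive. apply ex_derive_densities. }
pose (W := fun lam => RInt (fun psi => f (lam * sin psi)) 0 (2 * PI)).
assert (HW : continuity W) by (apply continuity_RInt_scaled_sin; [lra|exact Hf]).
assert (W0 : W 0 = 0).
{ unfold W. transitivity (RInt (fun _ => 0) 0 (2 * PI)).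
  - apply RInt_ext. intros x _. rewrite Rmult_0_l. unfold f.
    replace 0 with (shape_w 0) at 1 by (unfold shape_w; field; apply Rgt_not_eq, shape_m_pos).
    rewrite HVw. unfold angle_density, Rdiv. rewrite pow_i by auto with arith.
    rewrite Rmult_0_r. apply Rmult_0_l.
  - rewrite RInt_const. apply Rmult_0_r. }
pose (l1 := 2 * shape_w 1).
assert (Hw1 : 0 < shape_w 1).
{ unfold shape_w. apply Rdiv_lt_0_compat; [lra|apply shape_m_pos]. }
assert (Hex : forall a b, ex_RInt (fun psi => f (l1 * sin psi)) a b).
{ intros a b. apply (ex_RInt_continuous (fun psi => f (l1 * sin psi))). intros z _.
  apply continuous_of_continuity_pt.
  apply (continuity_pt_comp (fun x => l1 * sin x) f); [|apply Hf].
  apply continuity_of_ex_derive. auto_derive; easy. }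
assert (W1 : 2 * PI / 3 <= W l1).
{ assert (H1 : 0 <= RInt (fun psi => f (l1 * sin psi)) 0 (PI / 6)).
  { apply RInt_ge_0; [lra|apply Hex|]. intros x _. apply angle_density_nonneg. }
  assert (H3 : 0 <= RInt (fun psi => f (l1 * sin psi)) (5 * PI / 6) (2 * PI)).
  { apply RInt_ge_0; [lra|apply Hex|]. intros x _. apply angle_density_nonneg. }
  assert (H2 : 2 * PI / 3 <= RInt (fun psi => f (l1 * sin psi)) (PI / 6) (5 * PI / 6)).
  { replace (2 * PI / 3) with (RInt (fun _ => 1) (PI / 6) (5 * PI / 6)).
    - apply RInt_le; [lra|apply (ex_RInt_const (V := R_NormedModule))|apply Hex|].
      intros x Hx. apply angle_density_ge_1.
      rewrite <- (HVw 1).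
      assert (Hs : / 2 <= sin x).
      { destruct (Rle_or_lt x (PI / 2)) as [h|h].
        - replace (/ 2) with (sin (PI / 6)) by (rewrite sin_PI6; lra).
          apply sin_incr_1; lra.
        - replace (/ 2) with (sin (5 * PI / 6)).
          + apply sin_decr_1; lra.
          + replace (5 * PI / 6) with (PI - PI / 6) by field.
            rewrite sin_PI_x, sin_PI6. lra. }
      assert (Hv : shape_w 1 <= l1 * sin x) by (unfold l1; nra).
      destruct Hv as [h|h]; [left; now apply Vinc|right; now rewrite <- h].
    - rewrite RInt_const. unfold scal; simpl; unfold mult; simpl. field. }
  unfold W.
  rewrite <- (RInt_Chasles _ 0 (PI / 6) (2 * PI) (Hex _ _) (Hex _ _)).
  rewrite <- (RInt_Chasles _ (PI / 6) (5 * PI / 6) (2 * PI) (Hex _ _) (Hex _ _)).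
  unfold plus; simpl. lra. }
destruct (IVT_gen W 0 l1 delta HW) as [lam [Hlam HWl]].
- rewrite W0. rewrite Rmin_left, Rmax_right; lra.
- exists lam. split; [|exact HWl].
  rewrite Rmin_left in Hlam by (unfold l1; lra).
  destruct (proj1 Hlam) as [h|h]; [exact h|].
  rewrite <- h, W0 in HWl. lra.
Qed.

(** * The closed orbits *)

(** Both [ln r] and [th] are an exact term plus the primitive of a periodic
    density in the phase; over a libration the first density, being odd,
    integrates to zero and the second one to [delta]. *)
Lemma reduced_orbit (delta : R) : 0 < delta <= 2 * PI / 3 ->
  exists (lam : R) (tau r th : R -> R),
    0 < lam /\
    (forall psi, is_derive tau psi
       (lam * shape_m (tau psi) * cos psi / (16 * shape_q (tau psi)))) /\
    (forall psi, shape_w (tau psi) = lam * sin psi) /\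
    (forall psi, 0 < r psi) /\
    (forall psi, is_derive r psi
       (r psi * orbit_kappa lam (tau psi) (cos psi) / (2 * shape_q (tau psi)))) /\
    (forall psi, is_derive th psi
       (orbit_beta lam (tau psi) (cos psi) / (2 * shape_q (tau psi)))) /\
    (forall psi, tau (psi + 2 * PI) = tau psi) /\
    (forall psi, r (psi + 2 * PI) = r psi) /\
    (forall psi, th (psi + 2 * PI) = th psi + delta).
Proof.
intros Hdelta.
destruct shape_w_inverse as (V & HwV & HVw & DV).
destruct (winding_value V delta HwV HVw DV Hdelta) as (lam & Hlam & Hwind).
pose (tau := fun psi => V (lam * sin psi)).
assert (Dtau : forall psi, is_derive tau psi
   (lam * shape_m (tau psi) * cos psi / (16 * shape_q (tau psi)))).
{ intros psi.
  replace (_ / _) with (lam * cos psi * (shape_m (tau psi) / (16 * shape_q (tau psi)))).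
  2: field; apply Rgt_not_eq, shape_q_pos.
  apply (is_derive_comp V (fun x => lam * sin x)); [apply DV|].
  auto_derive; [easy|ring]. }
assert (Ptau : forall psi, tau (psi + 2 * PI) = tau psi).
{ intros psi. unfold tau.
  now rewrite sin_plus, sin_2PI, cos_2PI, Rmult_0_r, Rplus_0_r, Rmult_1_r. }
assert (Otau : forall psi, tau (- psi) = - tau psi).
{ intros psi. unfold tau. rewrite sin_neg, <- Ropp_mult_distr_r.
  rewrite <- (HwV (lam * sin psi)) at 1. now rewrite <- shape_w_opp, HVw. }
assert (Cdens : forall g : R -> R, (forall y, ex_derive g y) ->
  forall psi, continuous (fun psi => g (tau psi)) psi).
{ intros g Hg psi. apply continuous_of_continuity_pt.
  apply (continuity_pt_comp tau g).
  - exact (derive_continuity_pt _ _ _ (Dtau psi)).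
  - apply continuity_of_ex_derive, Hg. }
assert (CA := Cdens angle_density (fun y => proj1 (ex_derive_densities y))).
assert (CS := Cdens scale_density (fun y => proj1 (proj2 (ex_derive_densities y)))).
pose (A := fun psi => RInt (fun s => angle_density (tau s)) 0 psi).
pose (S := fun psi => RInt (fun s => scale_density (tau s)) 0 psi).
assert (DA : forall psi, is_derive A psi (angle_density (tau psi)))
  by (apply primitive_derive; exact CA).
assert (DS : forall psi, is_derive S psi (scale_density (tau psi)))
  by (apply primitive_derive; exact CS).
assert (PA : forall psi, A (psi + 2 * PI) = A psi + delta).
{ intros psi. unfold A. rewrite <- Hwind.
  apply (primitive_shift (fun s => angle_density (tau s))); [exact CA|].
  intros x. now rewrite Ptau. }
(* The shape, hence the density of [ln r], is odd in the phase. *)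
assert (PS : forall psi, S (psi + 2 * PI) = S psi).
{ apply (primitive_odd_periodic (fun s => scale_density (tau s))); [exact CS| |].
  - intros x. now rewrite Ptau.
  - intros x. rewrite Otau. unfold scale_density, shape_q, shape_E.
    replace ((- tau x) ^ 2) with (tau x ^ 2) by ring. unfold Rdiv. ring. }
assert (Htau : forall psi, shape_w (tau psi) = lam * sin psi)
  by (intros; apply HwV).
clearbody A S tau.
exists lam, tau,
  (fun psi => exp (S psi - ln (shape_E (tau psi)) / 4)),
  (fun psi => A psi + atan (16 * tau psi) / 2).
split; [exact Hlam|]. split; [exact Dtau|]. split; [exact Htau|].
split; [intros; apply exp_pos|].
refine (conj _ (conj _ (conj Ptau (conj _ _)))).
- intros psi.
  assert (Et : Derive (fun s => tau s) psi = _) by apply (is_derive_unique _ _ _ (Dtau psi)).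
  assert (ES : Derive (fun s => S s) psi = _) by apply (is_derive_unique _ _ _ (DS psi)).
  assert (HE := shape_E_pos (tau psi)). assert (Hq := shape_q_pos (tau psi)).
  unfold shape_E at 1.
  auto_derive.
  + unfold shape_E in HE. simpl in HE.
    repeat split; try (eexists; apply Dtau); try (eexists; apply DS); lra.
  + rewrite ES, Et. change (1 + 256 * (tau psi * (tau psi * 1))) with (shape_E (tau psi)).
    change (S psi + - (ln (shape_E (tau psi)) * / 4)) with (S psi - ln (shape_E (tau psi)) / 4).
    generalize (exp (S psi - ln (shape_E (tau psi)) / 4)). intros e.
    unfold orbit_kappa, orbit_beta, scale_density.
    clear - HE Hq. generalize dependent (shape_q (tau psi)). intros q Hq.
    unfold shape_E in *. field. lra.
- intros psi.
  assert (Et : Derive (fun s => tau s) psi = _) by apply (is_derive_unique _ _ _ (Dtau psi)).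
  assert (EA : Derive (fun s => A s) psi = _) by apply (is_derive_unique _ _ _ (DA psi)).
  assert (HE := shape_E_pos (tau psi)). assert (Hq := shape_q_pos (tau psi)).
  auto_derive.
  + repeat split; try (eexists; apply Dtau); eexists; apply DA.
  + rewrite EA, Et. unfold orbit_beta, angle_density.
    clear - HE Hq. generalize dependent (shape_q (tau psi)). intros q Hq.
    unfold shape_E, Rsqr in *. field. repeat split; nra.
- intros psi. now rewrite PS, Ptau.
- intros psi. rewrite PA, Ptau. ring.
Qed.

Lemma is_derive_reparam (g s : R -> R) (t dg ds l : R) :
  is_derive g (s t) dg -> is_derive s t ds -> l = ds * dg ->
  is_derive (fun t => g (s t)) t l.
Proof. intros Hg Hs ->. exact (is_derive_comp g s t dg ds Hg Hs). Qed.

Theorem theorem1 (alpha : R) (halpha : 0 < alpha)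
    (k : nat) (hk : (3 <= k)%nat) (hodd : Nat.Odd k) :
  exists (T : R) (u : R -> phase),
    0 < T /\
    hamilton_solution (KH alpha) u /\
    (forall t : R, u (t + T) = u t) /\
    (forall t : R,
       config (u (t + T / INR k)) = rotz (2 * PI / INR k) (config (u t))).
Proof.
assert (Hpi := PI_RGT_0).
assert (Hk : 3 <= INR k) by (apply le_INR in hk; simpl in hk; lra).
destruct (reduced_orbit (2 * PI / INR k))
  as (lam & tau & r & th & Hlam & Dtau & Htau & Hr & Dr & Dth & Ptau & Pr & Pth).
{ split; [apply Rdiv_lt_0_compat; lra|].
  apply Rmult_le_compat_l; [lra|]. apply Rinv_le_contravar; lra. }
pose (beta := fun psi => orbit_beta lam (tau psi) (cos psi)).
pose (kappa := fun psi => orbit_kappa lam (tau psi) (cos psi)).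
(* [alpha] sets the scale of the angular momentum, [lam] being dimensionless. *)
pose (J := sqrt (2 * alpha) / lam).
assert (HJ : 0 < J) by (apply Rdiv_lt_0_compat; [apply sqrt_lt_R0; lra|exact Hlam]).
assert (HJ2 : alpha = J ^ 2 * lam ^ 2 / 2).
{ assert (H : sqrt (2 * alpha) ^ 2 = 2 * alpha) by (apply pow2_sqrt; lra).
  replace alpha with (sqrt (2 * alpha) ^ 2 / 2) at 1 by lra. unfold J. field. lra. }
assert (Pc : forall psi, cos (psi + 2 * PI) = cos psi).
{ intros psi. rewrite cos_plus, cos_2PI, sin_2PI. ring. }
destruct (periodic_clock (fun psi => r psi ^ 2 / (2 * J * shape_q (tau psi))) (2 * PI))
  as (T0 & s & HT0 & Ds & Ps).
{ lra. }
{ intros psi.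
  assert (Hq := shape_q_pos (tau psi)).
  apply continuous_of_continuity_pt, continuity_of_ex_derive.
  auto_derive. repeat split; try (eexists; apply Dr); try (eexists; apply Dtau).
  - apply ex_derive_densities.
  - apply Rgt_not_eq. apply Rmult_lt_0_compat; lra. }
{ intros psi. now rewrite Pr, Ptau. }
{ intros psi. apply Rdiv_lt_0_compat.
  - apply pow_lt, Hr.
  - apply Rmult_lt_0_compat; [lra|apply shape_q_pos]. }
pose (u := fun psi => polar_phase J (r psi) (th psi) (tau psi) (J * kappa psi) (J * beta psi)).
exists (INR k * T0), (fun t => u (s t)).
assert (Psn : forall n t, s (t + INR n * T0) = s t + INR n * (2 * PI))
  by (intros; now apply shift_iterate).
split; [apply Rmult_lt_0_compat; lra|split; [|split]].
- assert (Db := fun psi => beta_equation lam tau Hlam Dtau Htau psi).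
  assert (Dk := fun psi => kappa_equation lam tau Hlam Dtau Htau psi).
  assert (Dt := fun psi => tau_equation lam tau Dtau psi).
  fold kappa in Dk, Dt, Db. fold beta in Dk, Dt, Db.
  apply (hamilton_solution_polar alpha J (fun t => r (s t)) (fun t => th (s t))
    (fun t => tau (s t)) (fun t => J * kappa (s t)) (fun t => J * beta (s t)));
  intros t; cbv beta; [apply Hr|..];
  assert (Hrt := Hr (s t)); assert (Hq := shape_q_pos (tau (s t)));
  assert (Hsq : 0 < sqrt (1 + tau (s t) ^ 2)) by (apply sqrt_lt_R0; nra).
  + eapply is_derive_reparam; [apply Dr|apply Ds|]. fold (kappa (s t)). field. lra.
  + eapply is_derive_reparam; [apply Dth|apply Ds|]. fold (beta (s t)). field. lra.
  + eapply is_derive_reparam; [apply Dt|apply Ds|]. fold (kappa (s t)) (beta (s t)). field. lra.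
  + eapply (is_derive_reparam (fun psi => J * kappa psi));
      [apply is_derive_scal, Dk|apply Ds|].
    rewrite HJ2. field. lra.
  + eapply (is_derive_reparam (fun psi => J * beta psi));
      [apply is_derive_scal, Db|apply Ds|].
    rewrite HJ2. field. lra.
- intros t. cbv beta. rewrite Psn.
  assert (Pn : forall g : R -> R, (forall x, g (x + 2 * PI) = g x) ->
    g (s t + INR k * (2 * PI)) = g (s t)).
  { intros g Hg. rewrite (shift_iterate g (2 * PI) 0), Rmult_0_r, Rplus_0_r; [easy|].
    intros x. now rewrite Hg, Rplus_0_r. }
  unfold u, kappa, beta, polar_phase.
  rewrite (Pn tau Ptau), (Pn r Pr), (Pn cos Pc).
  rewrite (shift_iterate th _ _ Pth).
  replace (INR k * (2 * PI / INR k)) with (2 * PI) by (field; lra).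
  now rewrite sin_plus, cos_plus, sin_2PI, cos_2PI, !Rmult_1_r, !Rmult_0_r,
    Rplus_0_r, Rminus_0_r.
- intros t. replace (INR k * T0 / INR k) with T0 by (field; lra).
  rewrite Ps. unfold u, polar_phase, config, rotz; simpl.
  rewrite Pr, Ptau, Pth, cos_plus, sin_plus.
  apply f_equal2; [|reflexivity]. f_equal; ring.
Qed.
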